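(* Let $\nu_0\in\mathcal{P}_2(\mathbb{R}^d)$. For any $\nu_1,\tilde\nu_1\in\mathcal{P}_2(\mathbb{R}^d)$ and any $t>1$, $$W_2\big(\mathscr{E}^t(\nu_0,\nu_1),\mathscr{E}^t(\nu_0,\tilde\nu_1)\big)\le 2t\,W_2(\nu_1,\tilde\nu_1).$$
   Context: $\mathcal{P}_2(\mathbb{R}^d)$ is the set of Borel probability measures on $\mathbb{R}^d$ with finite second moment, and $W_2$ is the 2-Wasserstein distance, $W_2^2(\rho,\nu)=\inf_{\pi\in\Pi(\rho,\nu)}\int|x-y|^2\,d\pi(x,y)$, with $\Pi(\rho,\nu)$ the set of couplings of $\rho$ and $\nu$. Metric extrapolation: for $t>1$ and $\nu_0,\nu_1\in\mathcal{P}_2(\mathbb{R}^d)$, $\mathscr{E}^t(\nu_0,\nu_1)$ is the unique (known to exist) minimizer over $\rho\in\mathcal{P}_2(\mathbb{R}^d)$ of $\frac{W_2^2(\rho,\nu_1)}{2(t-1)}-\frac{W_2^2(\rho,\nu_0)}{2t}$. *)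

(* Defs.v *)
From mathcomp Require Import all_boot all_order all_algebra.
From mathcomp Require Import all_classical all_reals all_analysis.
Set Implicit Arguments.
Unset Strict Implicit.
Unset Printing Implicit Defensive.
Import Order.TTheory GRing.Theory Num.Theory.
Import numFieldNormedType.Exports.
Local Open Scope classical_set_scope.
Local Open Scope ring_scope.

(* R^d with its Borel sigma-algebra. The library's norm on 'rV[R]_d is the
   sup norm, whose open sets are the Euclidean ones; Euclidean distances are
   written out coordinatewise below. *)
Notation Rd R d := (g_sigma_algebraType (@open 'rV[R]_d)).

Section wasserstein.
Context {R : realType} {d : nat}.

Definition sqnorm (x : 'rV[R]_d) : R := \sum_(i < d) x 0 i ^+ 2.

Definition P2 : set (probability (Rd R d) R) :=
  [set mu | (\int[mu]_x (sqnorm (x : Rd R d))%:E < +oo)%E].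

(* Marginals are compared on measurable sets only: the values of a measure
   on non-measurable sets carry no meaning. *)
Definition coupling (mu nu : probability (Rd R d) R) :
    set (probability (Rd R d * Rd R d)%type R) :=
  [set pi | (forall A, measurable A -> pushforward pi fst A = mu A) /\
            (forall A, measurable A -> pushforward pi snd A = nu A)].

Definition W2sq (mu nu : probability (Rd R d) R) : \bar R :=
  ereal_inf [set (\int[pi]_z (sqnorm ((z.1 : 'rV[R]_d) - z.2))%:E)%E
            | pi in coupling mu nu].

Definition W2 (mu nu : probability (Rd R d) R) : \bar R := sqrte (W2sq mu nu).

(* Both terms are finite on P2, so the extended-real difference is genuine
   there. *)
Definition extrapolation_functional (t : R) (nu0 nu1 rho : probability (Rd R d) R)
    : \bar R :=
  (((2 * (t - 1))^-1)%:E * W2sq rho nu1 - ((2 * t)^-1)%:E * W2sq rho nu0)%E.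

(* The graph of the metric extrapolation. It is a relation, not a function,
   because two measures with the same values on measurable sets can still
   differ as Rocq terms. *)
Definition metric_extrapolation (t : R) (nu0 nu1 : probability (Rd R d) R) :
    set (probability (Rd R d) R) :=
  [set rho | P2 rho /\ forall sigma, P2 sigma ->
     (extrapolation_functional t nu0 nu1 rho <=
      extrapolation_functional t nu0 nu1 sigma)%E].

End wasserstein.

(* Main.v *)
Require Import Defs.
From mathcomp Require Import all_boot all_order all_algebra.
From mathcomp Require Import ring lra.
From mathcomp Require Import all_classical all_reals all_analysis measurable_realfun.
Set Implicit Arguments.
Unset Strict Implicit.
Unset Printing Implicit Defensive.
Import Order.TTheory GRing.Theory Num.Theory.
Import numFieldNormedType.Exports.
Local Open Scope classical_set_scope.
Local Open Scope ring_scope.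

(** Both minimality conditions are tested with the same competitor, the
    midpoint of rho and rho' in a suitable joint coupling. Let Y, Y', Z, Z',
    on one probability space, have laws nu1, nu1', rho, rho', with the pairs
    (Z,Y), (Y,Y'), (Y',Z') optimally coupled, and let M = (Z + Z')/2. The law
    of M is a competitor for both extrapolation problems. The proof adds the
    two minimality inequalities and uses that
    - W2^2(law M, nu1) <= E|M - Y|^2 and W2^2(law M, nu1') <= E|M - Y'|^2,
      since any coupling bounds W2^2 from above ([W2sq_le_msd]);
    - W2^2(., nu0) is semiconcave along the segment ([W2sq_midpoint]):
      W2^2(rho, nu0) + W2^2(rho', nu0)
        <= 2 W2^2(law M, nu0) + E|Z - Z'|^2 / 2,
      because an optimal coupling of M with some X of law nu0 can be realised
      together with (Z, Z'), and the parallelogram identity then applies.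
    The functional has weights 1/(2(t-1)) and -1/(2t). The parallelogram
    identity for M - Y and M - Y' leaves
      E|Z - Z'|^2 <= 2t E<Z - Z', Y - Y'>,
    and Young's inequality gives E|Z - Z'|^2 <= 4t^2 E|Y - Y'|^2, where
    E|Y - Y'|^2 = W2^2(nu1, nu1').

    All optimal couplings are replaced by couplings that are optimal up to an
    arbitrary e > 0, which the argument tolerates because no derivative along
    the segment is taken. This also makes an approximate gluing of couplings
    sufficient: cut R^d into countably many small cells C_k, and make the two
    plans conditionally independent given the cell of their common marginal.
    The two copies of the common variable then lie in the same cell instead
    of being equal ([glue_along_partition], [approximate_gluing]). The joint
    laws above all come from [approximate_optimal_extension]: a random vector X of law mu on any
    probability space can be joined by a vector of law nu at mean square
    distance at most W2^2(mu, nu) + e. *)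

(** * Measurability in R^d and partitions into small cells *)

Definition rat_cube (R : realType) (d : nat) (q : 'rV[rat]_d) (r : R) :
    set 'rV[R]_d :=
  [set y | forall i, `|ratr (q 0 i) - y 0 i| < r].

Lemma rat_cube_dense (R : realType) (d : nat) (r : R) (x : 'rV[R]_d) :
  0 < r -> exists q, rat_cube q r x.
Proof.
move=> r0.
have /choice[q qx] i : exists q : rat, `|ratr q - x 0 i| < r.
  have /rat_in_itvoo[q] : x 0 i - r < x 0 i + r by lra.
  by rewrite in_itv/= => qx; exists q; rewrite ltr_distl.
by exists (\row_i q i) => i; rewrite mxE.
Qed.

(** Second countability of R^d: this is what reduces Borel measurability of a
    vector-valued map to measurability of its coordinates. *)
Lemma rat_cube_basis (R : realType) (d : nat) (U : set 'rV[R]_d) (x : 'rV[R]_d) :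
  open U -> U x ->
  exists q (n : nat), rat_cube q n.+1%:R^-1 x /\ rat_cube q n.+1%:R^-1 `<=` U.
Proof.
move=> oU Ux.
have [e e0 xeU] : exists2 e : R, 0 < e & ball x e `<=` U.
  by apply/nbhs_ballP; exact: open_nbhs_nbhs.
have [n ne] : exists n, (n.+1%:R^-1 : R) < e / 2.
  exists (Num.trunc (e / 2)^-1).
  rewrite invf_plt ?posrE ?divr_gt0//; exact: truncnS_gt.
have n0 : 0 < (n.+1%:R^-1 : R) by rewrite invr_gt0.
have [q qx] := rat_cube_dense x n0.
exists q, n; split=> // y yq.
apply: xeU; split=> // i j; rewrite ord1 -ball_normE /ball_ /=.
have := yq j; have := qx j; move: ne; set z := n.+1%:R^-1 => ne.
set r : R := ratr _ => h1 h2.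
have := ler_distD r (x 0 j) (y 0 j); rewrite distrC in h1; lra.
Qed.

Lemma measurable_preimage_rat_cube (R : realType) (d : nat) (dT : measure_display)
    (T : measurableType dT) (f : T -> 'rV[R]_d) (q : 'rV[rat]_d) (r : R) :
  (forall i, measurable_fun setT (fun t => f t 0 i)) ->
  measurable (f @^-1` rat_cube q r).
Proof.
move=> mf.
have -> : f @^-1` rat_cube q r = \bigcap_(i in setT)
    (fun t => f t 0 i) @^-1` (ball (ratr (q 0 i) : R) r).
  apply/seteqP; split=> t /= h i; first by move=> _; rewrite -ball_normE; exact: h.
  by have := h i Logic.I; rewrite -ball_normE.
apply: fin_bigcap_measurable => // i _.
by rewrite -[X in measurable X]setTI; apply: mf => //; exact: measurable_ball.
Qed.

Lemma measurable_coord (R : realType) (d : nat) (i : 'I_d) :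
  measurable_fun setT (fun x : Rd R d => (x : 'rV[R]_d) 0 i).
Proof.
apply: (measurability _ (RGenOpens.measurableE R)).
move=> _ [_ [a [b ->] <-]]; rewrite setTI; apply: sub_sigma_algebra.
by apply: open_comp; [move=> x _; exact: coord_continuous | exact: interval_open].
Qed.

(** The preimage of an open set is a countable union of preimages of rational
    cubes, each of which is cut out by finitely many coordinate conditions. *)
Lemma measurable_rV (R : realType) (d : nat) (dT : measure_display)
    (T : measurableType dT) (f : T -> Rd R d) :
  (forall i, measurable_fun setT (fun t => (f t : 'rV[R]_d) 0 i)) ->
  measurable_fun setT f.
Proof.
move=> mf; apply: (@measurability _ _ T (Rd R d) setT f (@open 'rV[R]_d) erefl).
move=> _ [U oU <-]; rewrite setTI.
pose B (p : 'rV[rat]_d * nat) : set 'rV[R]_d := rat_cube p.1 p.2.+1%:R^-1.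
pose V p := if `[< B p `<=` U >] then f @^-1` (B p) else set0.
have -> : f @^-1` U = \bigcup_p V p.
  apply/seteqP; split=> [t /= Uft|t [p _]]; last first.
    by rewrite /V; case: asboolP => // BU; exact: BU.
  have [q [n [xq qU]]] := rat_cube_basis oU Uft.
  by exists (q, n) => //; rewrite /V; case: asboolP => // -[].
apply: countable_bigcupT_measurable => // p; rewrite /V; case: asboolP => // _.
exact: measurable_preimage_rat_cube.
Qed.

(** The cells are the rational cubes of a fixed radius, enumerated and made
    disjoint by removing from each the earlier ones. *)
Lemma rV_small_cells (R : realType) (d : nat) (e : R) : 0 < e ->
  exists C : nat -> set (Rd R d),
    [/\ forall k, measurable (C k), trivIset setT C, \bigcup_k C k = setT &
        forall k x y, C k x -> C k y -> sqnorm ((x : 'rV[R]_d) - y) <= e].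
Proof.
move=> e0.
(* Two points of a cube of radius r differ by at most 2r in each coordinate,
   so 4 d r^2 <= e is needed; r <= 1 gives r^2 <= r. *)
pose r : R := Num.min 1 (e / (4 * d%:R + 1)).
have d1 : 0 < 4 * d%:R + 1 :> R by rewrite ltr_wpDl// mulr_ge0.
have r0 : 0 < r by rewrite lt_min ltr01 divr_gt0.
have rr : r ^+ 2 *+ d *+ 4 <= e.
  have r1 : r <= 1 by rewrite ge_min lexx.
  have : r * (4 * d%:R + 1) <= e by rewrite -ler_pdivlMr// ge_min lexx orbT.
  have : r ^+ 2 * d%:R <= r * d%:R.
    by rewrite ler_wpM2r// expr2 ler_piMl// ltW.
  by rewrite -mulr_natr -(mulr_natr _ d); lra.
pose F n : set (Rd R d) :=
  if unpickle n is Some q then rat_cube q r else set0.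
exists (seqDU F); split.
- have mF n : measurable (F n).
    rewrite /F; case: unpickle => // q.
    by apply: (@measurable_preimage_rat_cube R d _ (Rd R d) id) => i;
      exact: measurable_coord.
  by move=> k; apply: measurableD => //; exact: bigsetU_measurable.
- exact: trivIset_seqDU.
- rewrite -seqDU_bigcup_eq; apply/seteqP; split=> // x _.
  have [q qx] := rat_cube_dense x r0.
  by exists (pickle q) => //; rewrite /F pickleK.
- move=> k x y [+ _] [+ _]; rewrite /F; case: unpickle => // q qx qy.
  apply: le_trans _ rr; rewrite -mulrnA mulnC mulrnA /sqnorm.
  rewrite -[X in _ <= _ *+ X]card_ord -sumr_const; apply: ler_sum => i _.
  rewrite !mxE -mulr_natl.
  have := qx i; have := qy i; set p : R := ratr _ => h1 h2.
  have : `|x 0 i - y 0 i| <= 2 * r.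
    by have := ler_distD p (x 0 i) (y 0 i); rewrite (distrC _ p); lra.
  by rewrite ler_norml => /andP[]; nra.
Qed.

(** * Gluing two probability measures along a partition *)

(** When [mu A = 0] this is [mu] itself, so that it is always a probability and
    [mu A * conditional mu mA S = mu (S `&` A)] holds without exception. *)
Definition conditional (R : realType) (dT : measure_display) (T : measurableType dT)
    (mu : probability T R) (A : set T) (mA : measurable A) : probability T R :=
  mnormalize (mrestr mu mA) mu.

Lemma conditionalE (R : realType) (dT : measure_display) (T : measurableType dT)
    (mu : probability T R) (A : set T) (mA : measurable A) (S : set T) :
  measurable S -> (mu A * conditional mu mA S)%E = mu (S `&` A).
Proof.
move=> mS; rewrite /conditional /= /mnormalize /= /mrestr setTI.
have muA : mu A \is a fin_num by rewrite fin_num_measure.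
have [A0|A0] := eqVneq (mu A) 0%E.
  rewrite A0 mul0e; apply/esym/eqP; rewrite eq_le measure_ge0 andbT -A0.
  by apply: le_measure; rewrite ?inE//; exact: measurableI.
have /negPf -> : mu A != +oo%E by move: muA; rewrite fin_numE => /andP[].
rewrite /= muleCA -{1}(fineK muA) -EFinM divff ?mule1//.
by rewrite fine_eq0.
Qed.

Lemma conditional_self (R : realType) (dT : measure_display) (T : measurableType dT)
    (mu : probability T R) (A : set T) (mA : measurable A) :
  mu A != 0%E -> conditional mu mA A = 1%E.
Proof.
move=> A0; have muA : mu A \is a fin_num by rewrite fin_num_measure.
have := conditionalE mu mA mA; rewrite setIid => cA.
by rewrite -[LHS]mul1e -(mulVe A0 muA) -muleA cA mulVe.
Qed.

Lemma measure_partition (R : realType) (dT : measure_display) (T : measurableType dT)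
    (mu : probability T R) (A : nat -> set T) (S : set T) :
  (forall k, measurable (A k)) -> trivIset setT A -> \bigcup_k A k = setT ->
  measurable S -> mu S = (\sum_(0 <= k <oo) mu (S `&` A k))%E.
Proof.
move=> mA tA cA mS; rewrite -[in LHS](setIT S) -cA setI_bigcupr.
rewrite measure_bigcup//; first by apply: eq_eseriesl => i; rewrite in_setT.
- by move=> k _; exact: measurableI.
- exact: trivIset_setIl.
Qed.

(** The glued measure is the mixture of the products P(. | A_k) x Q(. | B_k)
    with weights P(A_k) = Q(B_k): the k-th product lives on A_k x B_k, and
    summing a marginal over k is the law of total probability. *)
Lemma glue_along_partition (R : realType) (d1 d2 : measure_display)
    (T1 : measurableType d1) (T2 : measurableType d2)
    (P : probability T1 R) (Q : probability T2 R)
    (A : nat -> set T1) (B : nat -> set T2) :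
  (forall k, measurable (A k)) -> trivIset setT A -> \bigcup_k A k = setT ->
  (forall k, measurable (B k)) -> trivIset setT B -> \bigcup_k B k = setT ->
  (forall k, P (A k) = Q (B k)) ->
  exists g : probability (T1 * T2)%type R,
    [/\ forall S, measurable S -> g (fst @^-1` S) = P S,
        forall S, measurable S -> g (snd @^-1` S) = Q S &
        g (~` \bigcup_k (A k `*` B k)) = 0%E].
Proof.
move=> mA tA cA mB tB cB AB.
have Pge0 k : 0 <= fine (P (A k)) by rewrite fine_ge0.
have PAE k : (fine (P (A k)))%:E = P (A k) by rewrite fineK// fin_num_measure.
pose pk k : probability (T1 * T2)%type R :=
  (conditional P (mA k) \x conditional Q (mB k))%E.
have pkE k S S' : measurable S -> measurable S' -> pk k (S `*` S') =
    (conditional P (mA k) S * conditional Q (mB k) S')%E.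
  by move=> mS mS'; exact: product_measure1E.
pose m : {measure set (T1 * T2) -> \bar R} :=
  mseries (fun k => mscale (NngNum (Pge0 k)) (pk k)) 0.
have mE S : m S = (\sum_(0 <= k <oo) (P (A k) * pk k S))%E.
  apply: eq_eseriesr => k _; exact: (congr1 (fun c => c * pk k S)%E (PAE k)).
have m1 S : measurable S -> m (fst @^-1` S) = P S.
  move=> mS; rewrite mE (measure_partition P mA tA cA mS).
  apply: eq_eseriesr => k _; rewrite -setXT pkE//.
  by rewrite probability_setT mule1 conditionalE.
have m2 S : measurable S -> m (snd @^-1` S) = Q S.
  move=> mS; rewrite mE (measure_partition Q mB tB cB mS).
  apply: eq_eseriesr => k _; rewrite -setTX pkE//.
  by rewrite probability_setT mul1e AB conditionalE.
have mT : m setT = 1%E by rewrite -(probability_setT P) -m1// preimage_setT.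
(* Since m has mass 1, normalising it only adds the probability structure. *)
pose g : probability (T1 * T2)%type R := mnormalize m (P \x Q)%E.
have gE S : g S = m S.
  by rewrite /g /= /mnormalize mT onee_eq0 /= invr1 mule1.
exists g; split=> [S mS|S mS|]; rewrite gE ?m1 ?m2// mE.
rewrite eseries0// => k _ _; rewrite muleC.
have [->|Ak0] := eqVneq (P (A k)) 0%E; first by rewrite mule0.
have kA1 : conditional P (mA k) (A k) = 1%E by exact: conditional_self.
have kB1 : conditional Q (mB k) (B k) = 1%E.
  by apply: conditional_self; rewrite -AB.
suff -> : pk k (~` \bigcup_k (A k `*` B k)) = 0%E by rewrite mul0e.
have mAB j : measurable (A j `*` B j) by exact: measurableX.
apply/eqP; rewrite eq_le measure_ge0 andbT.
apply: (@le_trans _ _ (pk k (~` (A k `*` B k)))).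
  apply: le_measure; rewrite ?inE; first 1 last.
  - exact: measurableC.
  - by apply: subsetC => z ?; exists k.
  - by apply: measurableC; exact: bigcup_measurable.
by rewrite probability_setC// pkE// kA1 kB1 mule1 subee.
Qed.

(** * Laws, mean square distance and approximate gluing *)

(** Laws are compared on measurable sets, as marginals are in [coupling]:
    [coupling mu nu pi] is [has_law pi fst mu /\ has_law pi snd nu]. *)
Definition has_law (R : realType) (dT dU : measure_display)
    (T : measurableType dT) (U : measurableType dU)
    (P : probability T R) (X : T -> U) (mu : probability U R) :=
  forall A, measurable A -> P (X @^-1` A) = mu A.

Lemma has_law_comp (R : realType) (dT dU dV : measure_display)
    (T : measurableType dT) (U : measurableType dU) (V : measurableType dV)
    (P : probability T R) (X : T -> U) (mu : probability U R)
    (Y : U -> V) (nu : probability V R) :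
  has_law P X mu -> measurable_fun setT Y -> has_law mu Y nu ->
  has_law P (Y \o X) nu.
Proof.
move=> PX mY muY A mA; rewrite comp_preimage PX ?muY//.
by rewrite -[X in measurable X]setTI; exact: mY.
Qed.

Lemma has_law_exists (R : realType) (dT dU : measure_display)
    (T : measurableType dT) (U : measurableType dU)
    (P : probability T R) (X : T -> U) :
  measurable_fun setT X -> exists mu, has_law P X mu.
Proof.
by move=> mX; exists (distribution P (mfun_Sub (mem_set mX))).
Qed.

Lemma ge0_integral_law (R : realType) (dT dU : measure_display)
    (T : measurableType dT) (U : measurableType dU)
    (P : probability T R) (X : T -> U) (mu : probability U R) (f : U -> \bar R) :
  measurable_fun setT X -> has_law P X mu ->
  (forall u, 0 <= f u)%E -> measurable_fun setT f ->
  (\int[P]_t f (X t) = \int[mu]_u f u)%E.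
Proof.
move=> mX PX f0 mf.
have -> : (\int[P]_t f (X t) = \int[pushforward P X]_u f u)%E.
  by rewrite ge0_integral_pushforward// preimage_setT.
by apply: eq_measure_integral => A mA _; exact: PX.
Qed.

Section sqnorm_theory.
Context {R : realType} {d : nat}.
Implicit Types x y z : 'rV[R]_d.

Lemma sqnorm_ge0 x : 0 <= sqnorm x.
Proof. by apply: sumr_ge0 => i _; exact: sqr_ge0. Qed.

Lemma sqnorm_young (h : R) x y z : 0 < h ->
  sqnorm (x - z) <= (1 + h) * sqnorm (x - y) + (1 + h^-1) * sqnorm (y - z).
Proof.
move=> h0; rewrite /sqnorm !mulr_sumr -big_split /=; apply: ler_sum => i _.
rewrite !mxE; set a := x 0 i; set b := y 0 i; set c := z 0 i.
have -> : a - c = (a - b) + (b - c) by ring.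
set u := a - b; set v := b - c.
rewrite -subr_ge0.
have -> : (1 + h) * u ^+ 2 + (1 + h^-1) * v ^+ 2 - (u + v) ^+ 2 =
    h^-1 * (h * u - v) ^+ 2 by field; rewrite gt_eqF.
by rewrite mulr_ge0 ?sqr_ge0// invr_ge0 ltW.
Qed.

Lemma sqnorm_sub_le x y : sqnorm (x - y) <= 2 * sqnorm x + 2 * sqnorm y.
Proof.
rewrite /sqnorm !mulr_sumr -big_split /=; apply: ler_sum => i _.
rewrite !mxE -subr_ge0; set a := x 0 i; set b := y 0 i.
have -> : 2 * a ^+ 2 + 2 * b ^+ 2 - (a - b) ^+ 2 = (a + b) ^+ 2 by ring.
exact: sqr_ge0.
Qed.

(** The parallelogram identity for x - z and y - z. *)
Lemma sqnorm_midpoint (x y z : 'rV[R]_d) :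
  sqnorm (x - z) + sqnorm (y - z) =
  2 * sqnorm (2^-1 *: (x + y) - z) + 2^-1 * sqnorm (x - y).
Proof.
rewrite /sqnorm !mulr_sumr -!big_split /=; apply: eq_bigr => i _.
by rewrite !mxE; field.
Qed.

(** The difference of the four squares is -2 <x - x', y - y'>; Young's
    inequality with weight s bounds it. *)
Lemma sqnorm_cross (s : R) x x' y y' : 0 < s ->
  sqnorm (x' - y) + sqnorm (x - y') <=
  sqnorm (x - y) + sqnorm (x' - y') +
  (s * sqnorm (x - x') + s^-1 * sqnorm (y - y')).
Proof.
move=> s0; rewrite /sqnorm !mulr_sumr -!big_split /=; apply: ler_sum => i _.
rewrite !mxE -subr_ge0; set a := x 0 i; set a' := x' 0 i.
set b := y 0 i; set b' := y' 0 i.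
have -> : (a - b) ^+ 2 + (a' - b') ^+ 2 +
    (s * (a - a') ^+ 2 + s^-1 * (b - b') ^+ 2) -
    ((a' - b) ^+ 2 + (a - b') ^+ 2) =
    s^-1 * (s * (a - a') - (b - b')) ^+ 2 by field; rewrite gt_eqF.
by rewrite mulr_ge0 ?sqr_ge0// invr_ge0 ltW.
Qed.

End sqnorm_theory.

Section mean_square_distance.
Context {R : realType} {d : nat} {dT : measure_display} {T : measurableType dT}.
Implicit Types (P : probability T R) (X Y Z : T -> Rd R d).

Definition msd P X Y : \bar R :=
  (\int[P]_t (sqnorm ((X t : 'rV[R]_d) - Y t))%:E)%E.

Lemma measurable_sqdist X Y :
  measurable_fun setT X -> measurable_fun setT Y ->
  measurable_fun setT (fun t => (sqnorm ((X t : 'rV[R]_d) - Y t))%:E).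
Proof.
move=> mX mY; apply/measurable_EFinP; apply: measurable_sum => i.
apply: measurable_funX.
apply: (eq_measurable_fun (fun t => (X t : 'rV[R]_d) 0 i - (Y t : 'rV[R]_d) 0 i)).
  by move=> t _; rewrite !mxE.
apply: measurable_funB.
- exact: measurableT_comp (measurable_coord i) mX.
- exact: measurableT_comp (measurable_coord i) mY.
Qed.

Lemma msd_ge0 P X Y : (0 <= msd P X Y)%E.
Proof. by apply: integral_ge0 => t _; rewrite lee_fin sqnorm_ge0. Qed.

End mean_square_distance.

Lemma msd_law (R : realType) (d : nat) (dT dU : measure_display)
    (T : measurableType dT) (U : measurableType dU)
    (P : probability T R) (Q : probability U R) (phi : T -> U)
    (X Y : U -> Rd R d) :
  measurable_fun setT phi -> has_law P phi Q ->
  measurable_fun setT X -> measurable_fun setT Y ->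
  msd P (X \o phi) (Y \o phi) = msd Q X Y.
Proof.
move=> mphi Pphi mX mY.
apply: (ge0_integral_law (f := fun u => (sqnorm ((X u : 'rV[R]_d) - Y u))%:E)) => //.
- by move=> u; rewrite lee_fin sqnorm_ge0.
- exact: measurable_sqdist.
Qed.

(** The joint law of X and Y is a coupling of mu and nu. *)
Lemma W2sq_le_msd (R : realType) (d : nat) (dT : measure_display)
    (T : measurableType dT) (P : probability T R) (X Y : T -> Rd R d)
    (mu nu : probability (Rd R d) R) :
  measurable_fun setT X -> measurable_fun setT Y ->
  has_law P X mu -> has_law P Y nu -> (W2sq mu nu <= msd P X Y)%E.
Proof.
move=> mX mY PX PY.
have mXY := measurable_fun_pair mX mY.
have [pi piP] := has_law_exists P mXY.
apply: ereal_inf_lbound; exists pi.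
  split=> A mA; rewrite /pushforward -piP.
  - exact: PX.
  - by rewrite -[X in measurable X]setTI; exact: measurable_fst.
  - exact: PY.
  - by rewrite -[X in measurable X]setTI; exact: measurable_snd.
by apply/esym/(msd_law (X := fst) (Y := snd) mXY piP);
  [exact: measurable_fst | exact: measurable_snd].
Qed.

(** Both spaces are partitioned by the cell of the common variable, so under
    the glued measure the two copies of it almost surely share a cell. *)
Lemma approximate_gluing (R : realType) (d : nat) (d1 d2 : measure_display)
    (T1 : measurableType d1) (T2 : measurableType d2)
    (P : probability T1 R) (Q : probability T2 R)
    (X : T1 -> Rd R d) (Y : T2 -> Rd R d) (mu : probability (Rd R d) R) (e : R) :
  0 < e -> measurable_fun setT X -> measurable_fun setT Y ->
  has_law P X mu -> has_law Q Y mu ->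
  exists g : probability (T1 * T2)%type R,
    [/\ has_law g fst P, has_law g snd Q & (msd g (X \o fst) (Y \o snd) <= e%:E)%E].
Proof.
move=> e0 mX mY PX QY.
have [C [mC tC cC sC]] := rV_small_cells d e0.
have mXC k : measurable (X @^-1` C k) by rewrite -[X in measurable X]setTI; exact: mX.
have mYC k : measurable (Y @^-1` C k) by rewrite -[X in measurable X]setTI; exact: mY.
have [||||| g [g1 g2 g0]] := @glue_along_partition R d1 d2 T1 T2 P Q
    (fun k => X @^-1` C k) (fun k => Y @^-1` C k) mXC _ _ mYC _ _ _.
- by move=> i j _ _ [t [Ci Cj]]; apply: tC => //; exists (X t).
- by rewrite -preimage_bigcup cC preimage_setT.
- by move=> i j _ _ [t [Ci Cj]]; apply: tC => //; exists (Y t).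
- by rewrite -preimage_bigcup cC preimage_setT.
- by move=> k; rewrite PX// QY.
exists g; split=> //.
have mX1 := measurableT_comp mX (@measurable_fst _ _ T1 T2).
have mY2 := measurableT_comp mY (@measurable_snd _ _ T1 T2).
rewrite -[leRHS]mule1 -(probability_setT g) -integral_cst//.
apply: ae_ge0_le_integral => //.
- by move=> z _; rewrite lee_fin sqnorm_ge0.
- exact: measurable_sqdist.
- by move=> z _; rewrite lee_fin ltW.
exists (~` \bigcup_k (X @^-1` C k `*` Y @^-1` C k)); split => //.
  by apply: measurableC; apply: bigcup_measurable => k _; exact: measurableX.
apply: subsetC => z [k _ [Xz Yz]] _; rewrite lee_fin.
exact: sC Xz Yz.
Qed.

(** * Identities and inequalities for mean square distances *)

Section msd_identities.
Context {R : realType} {d : nat} {dT : measure_display} {T : measurableType dT}.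
Variable P : probability T R.
Implicit Types X Y Z : T -> Rd R d.

Lemma integral_sqdist_lin (a b : R) X Y X' Y' : 0 <= a -> 0 <= b ->
  measurable_fun setT X -> measurable_fun setT Y ->
  measurable_fun setT X' -> measurable_fun setT Y' ->
  (\int[P]_t (a * sqnorm ((X t : 'rV[R]_d) - Y t) +
              b * sqnorm ((X' t : 'rV[R]_d) - Y' t))%:E =
   a%:E * msd P X Y + b%:E * msd P X' Y')%E.
Proof.
move=> a0 b0 mX mY mX' mY'.
have mXY := measurable_sqdist mX mY.
have mXY' := measurable_sqdist mX' mY'.
under eq_integral do rewrite EFinD !EFinM.
rewrite ge0_integralD//.
- rewrite !ge0_integralZl//; by move=> t _; rewrite lee_fin sqnorm_ge0.
- by move=> t _; rewrite -EFinM lee_fin mulr_ge0// sqnorm_ge0.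
- exact: measurable_funeM.
- by move=> t _; rewrite -EFinM lee_fin mulr_ge0// sqnorm_ge0.
- exact: measurable_funeM.
Qed.

Lemma measurable_sqdist_lin (a b : R) X Y X' Y' :
  measurable_fun setT X -> measurable_fun setT Y ->
  measurable_fun setT X' -> measurable_fun setT Y' ->
  measurable_fun setT (fun t =>
    (a * sqnorm ((X t : 'rV[R]_d) - Y t) +
     b * sqnorm ((X' t : 'rV[R]_d) - Y' t))%:E).
Proof.
move=> mX mY mX' mY'; apply/measurable_EFinP; apply: measurable_funD.
- by apply: measurable_funM => //; apply/measurable_EFinP; exact: measurable_sqdist.
- by apply: measurable_funM => //; apply/measurable_EFinP; exact: measurable_sqdist.
Qed.

Definition midpoint X Y : T -> Rd R d :=
  fun t => 2^-1 *: ((X t : 'rV[R]_d) + Y t).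

Lemma measurable_midpoint X Y :
  measurable_fun setT X -> measurable_fun setT Y ->
  measurable_fun setT (midpoint X Y).
Proof.
move=> mX mY; apply: measurable_rV => i.
apply: (eq_measurable_fun
    (fun t => 2^-1 * ((X t : 'rV[R]_d) 0 i + (Y t : 'rV[R]_d) 0 i))).
  by move=> t _; rewrite !mxE.
apply: measurable_funM => //; apply: measurable_funD.
- exact: measurableT_comp (measurable_coord i) mX.
- exact: measurableT_comp (measurable_coord i) mY.
Qed.

Lemma msd_midpoint X Y Z :
  measurable_fun setT X -> measurable_fun setT Y -> measurable_fun setT Z ->
  (msd P X Z + msd P Y Z =
   2%:E * msd P (midpoint X Y) Z + 2^-1%:E * msd P X Y)%E.
Proof.
move=> mX mY mZ; have mM := measurable_midpoint mX mY.
rewrite -[msd P X Z]mul1e -[msd P Y Z]mul1e -!integral_sqdist_lin//.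
by apply: eq_integral => t _; rewrite !mul1r sqnorm_midpoint.
Qed.

Lemma msd_cross (s : R) (X X' Y Y' : T -> Rd R d) : 0 < s ->
  measurable_fun setT X -> measurable_fun setT X' ->
  measurable_fun setT Y -> measurable_fun setT Y' ->
  (msd P X' Y + msd P X Y' <= (msd P X Y + msd P X' Y') +
    (s%:E * msd P X X' + s^-1%:E * msd P Y Y'))%E.
Proof.
move=> s0 mX mX' mY mY'.
have s'0 : 0 < s^-1 by rewrite invr_gt0.
rewrite -[msd P X' Y]mul1e -[msd P X Y']mul1e.
rewrite -[msd P X Y]mul1e -[msd P X' Y']mul1e.
rewrite -!integral_sqdist_lin ?(ltW s0) ?(ltW s'0)//.
have ge0 (a b : R) (x y x' y' : 'rV[R]_d) : 0 <= a -> 0 <= b ->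
    0 <= a * sqnorm (x - y) + b * sqnorm (x' - y').
  by move=> a0 b0; rewrite addr_ge0// mulr_ge0// sqnorm_ge0.
rewrite -ge0_integralD//; first last.
- exact: measurable_sqdist_lin.
- by move=> t _; rewrite lee_fin ge0// ltW.
- exact: measurable_sqdist_lin.
- by move=> t _; rewrite lee_fin ge0.
apply: ge0_le_integral => //.
- by move=> t _; rewrite lee_fin ge0.
- exact: measurable_sqdist_lin.
- by apply: emeasurable_funD; exact: measurable_sqdist_lin.
by move=> t _; rewrite -EFinD lee_fin !mul1r sqnorm_cross.
Qed.

End msd_identities.

(** * Finite second moments, near-optimal couplings, semiconcavity *)

Section finiteness.
Context {R : realType} {d : nat} {dT : measure_display} {T : measurableType dT}.
Variable P : probability T R.
Implicit Types (X Y : T -> Rd R d) (mu nu : probability (Rd R d) R).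

Local Notation origin := (fun=> 0 : Rd R d).

(** The second moment is a mean square distance to the constant 0, so that
    finiteness questions reduce to identities between mean square distances. *)
Lemma P2_law X mu : measurable_fun setT X -> has_law P X mu ->
  P2 mu = (msd P X origin < +oo)%E.
Proof.
move=> mX PX.
have -> : msd P X origin = msd mu id origin by exact: msd_law PX _ _.
rewrite /P2 /msd /=; congr is_true; congr Order.lt.
by apply: eq_integral => x _; rewrite subr0.
Qed.

Lemma msd_lty X Y mu nu : measurable_fun setT X -> measurable_fun setT Y ->
  has_law P X mu -> has_law P Y nu -> P2 mu -> P2 nu -> (msd P X Y < +oo)%E.
Proof.
move=> mX mY PX PY; rewrite (P2_law mX PX) (P2_law mY PY) => Xoo Yoo.
have m0 : measurable_fun setT (origin : T -> _) by exact: measurable_cst.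
apply: (@le_lt_trans _ _ (2%:E * msd P X origin + 2%:E * msd P Y origin)%E).
  rewrite -integral_sqdist_lin//; apply: ge0_le_integral => //.
  - by move=> t _; rewrite lee_fin sqnorm_ge0.
  - exact: measurable_sqdist.
  - exact: measurable_sqdist_lin.
  - by move=> t _; rewrite lee_fin !subr0 sqnorm_sub_le.
by apply: lte_add_pinfty; apply: lte_mul_pinfty.
Qed.

Lemma P2_midpoint X Y rho rho' mu :
  measurable_fun setT X -> measurable_fun setT Y ->
  has_law P X rho -> has_law P Y rho' -> has_law P (midpoint X Y) mu ->
  P2 rho -> P2 rho' -> P2 mu.
Proof.
move=> mX mY PX PY PM.
have m0 : measurable_fun setT (origin : T -> _) by exact: measurable_cst.
rewrite (P2_law mX PX) (P2_law mY PY) (P2_law (measurable_midpoint mX mY) PM).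
move=> Xoo Yoo; have := lte_add_pinfty Xoo Yoo; rewrite msd_midpoint//.
have M0 := msd_ge0 P (midpoint X Y) origin.
have D0 := msd_ge0 P X Y.
case: (msd P (midpoint X Y) origin) M0 => [r _ _| |]; rewrite ?ltry//.
by move=> _; rewrite gt0_muley ?lte_fin// addye// gt_eqF// (lt_le_trans ltNy0) ?mule_ge0.
Qed.

End finiteness.

Lemma has_law_fst (R : realType) (d1 d2 : measure_display)
    (T1 : measurableType d1) (T2 : measurableType d2)
    (P : probability T1 R) (Q : probability T2 R) :
  has_law (P \x Q)%E fst P.
Proof.
move=> A mA; rewrite -setXT -[RHS]mule1 -(probability_setT Q).
exact: product_measure1E.
Qed.

Lemma has_law_snd (R : realType) (d1 d2 : measure_display)
    (T1 : measurableType d1) (T2 : measurableType d2)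
    (P : probability T1 R) (Q : probability T2 R) :
  has_law (P \x Q)%E snd Q.
Proof.
move=> A mA; rewrite -setTX -[RHS]mul1e -(probability_setT P).
exact: product_measure1E.
Qed.

Section couplings.
Context {R : realType} {d : nat}.
Implicit Types mu nu : probability (Rd R d) R.

Lemma W2sq_ge0 mu nu : (0 <= W2sq mu nu)%E.
Proof. by apply: le_ereal_inf_tmp => _ [pi _ <-]; exact: msd_ge0. Qed.

Lemma W2sq_fin_num mu nu : P2 mu -> P2 nu -> W2sq mu nu \is a fin_num.
Proof.
move=> mu2 nu2; rewrite ge0_fin_numE ?W2sq_ge0//.
pose pi : probability (Rd R d * Rd R d)%type R := (mu \x nu)%E.
have pi1 : has_law pi fst mu by exact: has_law_fst.
have pi2 : has_law pi snd nu by exact: has_law_snd.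
apply: (@le_lt_trans _ _ (msd pi fst snd)).
  exact: W2sq_le_msd.
exact: (msd_lty _ _ pi1 pi2).
Qed.

(** Take a near-optimal coupling (a, b) of mu and nu, glue X approximately to
    a, and keep only X and b. Young's inequality
    |X - b|^2 <= (1 + h)|a - b|^2 + (1 + 1/h)|X - a|^2 absorbs the gluing error
    once E|X - a|^2 <= h^2. *)
Lemma approximate_optimal_extension (dT : measure_display) (T : measurableType dT)
    (P : probability T R) (X : T -> Rd R d) mu nu (e : R) :
  0 < e -> measurable_fun setT X -> has_law P X mu ->
  W2sq mu nu \is a fin_num ->
  exists g : probability (T * Rd R d)%type R,
    [/\ has_law g fst P, has_law g snd nu &
        (msd g (X \o fst) snd <= W2sq mu nu + e%:E)%E].
Proof.
move=> e0 mX PX Wfin.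
pose w := fine (W2sq mu nu).
have wE : W2sq mu nu = w%:E by rewrite fineK.
have w0 : 0 <= w by rewrite fine_ge0// W2sq_ge0.
have w4 : 0 < w + 4 by rewrite ltr_wpDl.
(* With h <= 1 the total is at most
   (1 + h)(w + h) + (1 + 1/h) h^2 <= w + h (w + 4). *)
pose h : R := Num.min 1 (e / (w + 4)).
have h0 : 0 < h by rewrite lt_min ltr01 divr_gt0.
have h1 : h <= 1 by rewrite ge_min lexx.
have hw : h * (w + 4) <= e by rewrite -ler_pdivlMr// ge_min lexx orbT.
have [_ [pi [pi1 pi2] <-]] := lb_ereal_inf_adherent h0 Wfin.
rewrite -/(W2sq mu nu) wE -EFinD -/(msd pi fst snd) => piW.
have m1 : measurable_fun setT (@fst (Rd R d) (Rd R d)) by exact: measurable_fst.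
have m2 : measurable_fun setT (@snd (Rd R d) (Rd R d)) by exact: measurable_snd.
have [g0 [g1 g2 gclose]] := approximate_gluing (exprn_gt0 2 h0) mX m1 PX pi1.
have mf : measurable_fun setT (@fst T (Rd R d * Rd R d)%type) by exact: measurable_fst.
have ms : measurable_fun setT (@snd T (Rd R d * Rd R d)%type) by exact: measurable_snd.
have mXf : measurable_fun setT (X \o fst : T * (Rd R d * Rd R d) -> _).
  exact: measurableT_comp.
have mfs : measurable_fun setT (fst \o snd : T * (Rd R d * Rd R d) -> _).
  exact: measurableT_comp.
have mss : measurable_fun setT (snd \o snd : T * (Rd R d * Rd R d) -> _).
  exact: measurableT_comp.
have mphi := measurable_fun_pair mf mss.
have [g gP] := has_law_exists g0 mphi.
exists g; split.
- move=> A mA; rewrite -gP; first exact: g1.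
  by rewrite -[X in measurable X]setTI; exact: measurable_fst.
- move=> A mA; rewrite -gP; last first.
    by rewrite -[X in measurable X]setTI; exact: measurable_snd.
  exact: (has_law_comp g2 m2 pi2).
have <- : msd g0 (X \o fst) (snd \o snd) = msd g (X \o fst) snd.
  apply: (msd_law (X := X \o fst) (Y := snd) mphi gP).
  - by apply: measurableT_comp => //; exact: measurable_fst.
  - exact: measurable_snd.
have h'0 : 0 < h^-1 by rewrite invr_gt0.
apply: (@le_trans _ _ ((1 + h^-1)%:E * msd g0 (X \o fst) (fst \o snd) +
                       (1 + h)%:E * msd g0 (fst \o snd) (snd \o snd))%E).
  rewrite -integral_sqdist_lin ?addr_ge0 ?(ltW h0) ?(ltW h'0)//.
  apply: ge0_le_integral => //.
  - by move=> t _; rewrite lee_fin sqnorm_ge0.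
  - exact: measurable_sqdist.
  - exact: measurable_sqdist_lin.
  - move=> z _; rewrite lee_fin -{2}(invrK h); exact: sqnorm_young.
have -> : msd g0 (fst \o snd) (snd \o snd) = msd pi fst snd.
  exact: (msd_law (X := fst) (Y := snd) ms g2).
apply: (@le_trans _ _ ((1 + h^-1)%:E * (h ^+ 2)%:E + (1 + h)%:E * (w + h)%:E)%E).
  apply: leeD; apply: lee_wpmul2l => //; rewrite ?lee_fin ?addr_ge0 ?ltW//.
rewrite -!EFinM -!EFinD lee_fin.
have -> : (1 + h^-1) * h ^+ 2 = h ^+ 2 + h by field; rewrite gt_eqF.
have : h ^+ 2 <= h by rewrite expr2 ler_piMl// ltW.
by lra.
Qed.

(** Semiconcavity of W2^2(., nu) along a segment of random vectors: extend the
    space by a near-optimal partner of the midpoint, which is also an admissible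
    partner of both endpoints, and use the parallelogram identity. *)
Lemma W2sq_midpoint (dT : measure_display) (T : measurableType dT)
    (P : probability T R) (X Y : T -> Rd R d) (rho rho' mu nu : probability (Rd R d) R) :
  measurable_fun setT X -> measurable_fun setT Y ->
  has_law P X rho -> has_law P Y rho' -> has_law P (midpoint X Y) mu ->
  W2sq mu nu \is a fin_num ->
  (W2sq rho nu + W2sq rho' nu <= 2%:E * W2sq mu nu + 2^-1%:E * msd P X Y)%E.
Proof.
move=> mX mY PX PY PM Wfin; apply/lee_addgt0Pr => e e0.
have e2 : 0 < e / 2 by rewrite divr_gt0.
have mM := measurable_midpoint mX mY.
have [g [g1 g2 gM]] := approximate_optimal_extension e2 mM PM Wfin.
have mf : measurable_fun setT (@fst T (Rd R d)) by exact: measurable_fst.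
have ms : measurable_fun setT (@snd T (Rd R d)) by exact: measurable_snd.
have mXf : measurable_fun setT (X \o fst : T * Rd R d -> _) by exact: measurableT_comp.
have mYf : measurable_fun setT (Y \o fst : T * Rd R d -> _) by exact: measurableT_comp.
apply: (@le_trans _ _ (msd g (X \o fst) snd + msd g (Y \o fst) snd)%E).
  apply: leeD; apply: W2sq_le_msd => //.
  - exact: has_law_comp g1 mX PX.
  - exact: has_law_comp g1 mY PY.
rewrite msd_midpoint//.
have -> : msd g (X \o fst) (Y \o fst) = msd P X Y by exact: msd_law.
rewrite addeAC; apply: leeD => //.
apply: (@le_trans _ _ (2%:E * (W2sq mu nu + (e / 2)%:E))%E).
  by apply: lee_wpmul2l; rewrite ?lee_fin.
by rewrite muleDr ?fin_num_adde_defr// -EFinM mulrC divfK.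
Qed.

End couplings.

(** * Lipschitz dependence of the extrapolation on its second endpoint *)

(** The minimality of rho, multiplied by 2t(t - 1) to clear denominators; on
    measures with finite second moment all costs are real numbers. *)
Lemma extrapolation_minimality (R : realType) (d : nat) (t : R)
    (nu0 nu1 rho sigma : probability (Rd R d) R) :
  1 < t -> P2 nu0 -> P2 nu1 -> metric_extrapolation t nu0 nu1 rho -> P2 sigma ->
  t * fine (W2sq rho nu1) - (t - 1) * fine (W2sq rho nu0) <=
  t * fine (W2sq sigma nu1) - (t - 1) * fine (W2sq sigma nu0).
Proof.
move=> t1 nu0_P2 nu1_P2 [rho_P2 rhomin] sigma_P2.
have := rhomin _ sigma_P2; rewrite /extrapolation_functional.
have WE (mu nu : probability (Rd R d) R) : P2 mu -> P2 nu ->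
    W2sq mu nu = (fine (W2sq mu nu))%:E.
  by move=> mu2 nu2; rewrite fineK// W2sq_fin_num.
rewrite (WE rho nu1)// (WE rho nu0)// (WE sigma nu1)// (WE sigma nu0)//=.
rewrite -!EFinM -!EFinB lee_fin.
set r1 := fine _; set r0 := fine _; set s1 := fine _; set s0 := fine _.
have c0 : 0 < 2 * t * (t - 1) by rewrite !mulr_gt0//; lra.
rewrite -(ler_pM2l c0).
have tt : t != 0 by rewrite gt_eqF//; lra.
have tt1 : t - 1 != 0 by rewrite gt_eqF//; lra.
have E x y : 2 * t * (t - 1) * ((2 * (t - 1))^-1 * x - (2 * t)^-1 * y) =
  t * x - (t - 1) * y by field; rewrite tt tt1.
by rewrite !E.
Qed.

Lemma msd_sym (R : realType) (d : nat) (dT : measure_display)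
    (T : measurableType dT) (P : probability T R) (X Y : T -> Rd R d) :
  msd P X Y = msd P Y X.
Proof.
apply: eq_integral => t _; congr EFin; apply: eq_bigr => i _.
by rewrite !mxE -sqrrN opprB.
Qed.

Lemma W2sq_sym (R : realType) (d : nat) (mu nu : probability (Rd R d) R) :
  W2sq mu nu = W2sq nu mu.
Proof.
apply/eqP; rewrite eq_le; apply/andP; split;
  apply: le_ereal_inf_tmp => _ [pi [pi1 pi2] <-]; rewrite -/(msd pi fst snd) msd_sym;
  exact: W2sq_le_msd.
Qed.

(** The chain Z - Y - Y' - Z' is built from Y outwards by three successive
    near-optimal extensions. *)
Lemma four_point_coupling (R : realType) (d : nat)
    (nu nu' rho rho' : probability (Rd R d) R) (e : R) :
  0 < e -> P2 nu -> P2 nu' -> P2 rho -> P2 rho' ->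
  exists (dT : measure_display) (T : measurableType dT) (P : probability T R)
         (Y Y' Z Z' : T -> Rd R d),
    [/\ [/\ measurable_fun setT Y, measurable_fun setT Y',
            measurable_fun setT Z & measurable_fun setT Z'],
        [/\ has_law P Y nu, has_law P Y' nu', has_law P Z rho & has_law P Z' rho'] &
        [/\ (msd P Y Y' <= W2sq nu nu' + e%:E)%E,
            (msd P Z Y <= W2sq rho nu + e%:E)%E &
            (msd P Z' Y' <= W2sq rho' nu' + e%:E)%E]].
Proof.
move=> e0 nu_P2 nu'_P2 rho_P2 rho'_P2.
have idP : has_law nu (@id (Rd R d)) nu by [].
have mid : measurable_fun setT (@id (Rd R d)) by [].
have [g1 [g1f g1s g1d]] :=
  approximate_optimal_extension e0 mid idP (W2sq_fin_num nu_P2 nu'_P2).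
have m1 : measurable_fun setT (@fst (Rd R d) (Rd R d)) by exact: measurable_fst.
have m2 : measurable_fun setT (@snd (Rd R d) (Rd R d)) by exact: measurable_snd.
have [g2 [g2f g2s g2d]] :=
  approximate_optimal_extension e0 m1 g1f (W2sq_fin_num nu_P2 rho_P2).
have m3 : measurable_fun setT (@fst (Rd R d * Rd R d)%type (Rd R d)).
  exact: measurable_fst.
have m4 : measurable_fun setT (@snd (Rd R d * Rd R d)%type (Rd R d)).
  exact: measurable_snd.
have m23 := measurableT_comp m2 m3.
have m13 := measurableT_comp m1 m3.
have [g3 [g3f g3s g3d]] := approximate_optimal_extension e0 m23
  (has_law_comp g2f m2 g1s) (W2sq_fin_num nu'_P2 rho'_P2).
have m5 : measurable_fun setT (@fst (Rd R d * Rd R d * Rd R d)%type (Rd R d)).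
  exact: measurable_fst.
exists _, _, g3, (fst \o fst \o fst), (snd \o fst \o fst), (snd \o fst), snd.
split.
- split; last exact: measurable_snd.
  + exact: (measurableT_comp m13 m5).
  + exact: (measurableT_comp m23 m5).
  + exact: (measurableT_comp m4 m5).
- split; last exact: g3s.
  + exact: (has_law_comp g3f m13 (has_law_comp g2f m1 g1f)).
  + exact: (has_law_comp g3f m23 (has_law_comp g2f m2 g1s)).
  + exact: (has_law_comp g3f m4 g2s).
split; last by rewrite msd_sym W2sq_sym.
- apply: le_trans g1d.
  rewrite (msd_law (X := fst \o fst) (Y := snd \o fst) m5 g3f m13 m23).
  by rewrite (msd_law (X := fst) (Y := snd) m3 g2f m1 m2).
- rewrite msd_sym (W2sq_sym rho); apply: le_trans g2d.
  by rewrite (msd_law (X := fst \o fst) (Y := snd) m5 g3f m13 m4).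
Qed.

Theorem proposition1 (R : realType) (d : nat)
    (nu0 : probability (Rd R d) R) (nu0_P2 : P2 nu0)
    (nu1 nu1' : probability (Rd R d) R) (nu1_P2 : P2 nu1) (nu1'_P2 : P2 nu1')
    (t : R) (t_gt1 : 1 < t)
    (rho rho' : probability (Rd R d) R)
    (rhoE : metric_extrapolation t nu0 nu1 rho)
    (rho'E : metric_extrapolation t nu0 nu1' rho') :
  (W2 rho rho' <= (2 * t)%:E * W2 nu1 nu1')%E.
Proof.
have [rho_P2 _] := rhoE; have [rho'_P2 _] := rho'E.
have t0 : 0 < t by lra.
suff W2sq_le : (W2sq rho rho' <= ((2 * t) ^+ 2)%:E * W2sq nu1 nu1')%E.
  have -> : ((2 * t)%:E = sqrte ((2 * t) ^+ 2)%:E :> \bar R)%E.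
    by rewrite /sqrte /= sqrtr_sqr ger0_norm// mulr_ge0// ltW.
  rewrite /W2 -sqrteM ?lee_fin ?sqr_ge0// lee_sqrt//.
  by rewrite mule_ge0 ?W2sq_ge0// lee_fin sqr_ge0.
apply/lee_addgt0Pr => e e0.
(* The slack h in each of the three couplings costs 8 t h through the pairs
   (Z, Y), (Z', Y') and 4 t^2 h through (Y, Y'). *)
pose h := e / (4 * t ^+ 2 + 8 * t).
have c0 : 0 < 4 * t ^+ 2 + 8 * t by rewrite addr_gt0// mulr_gt0// exprn_gt0.
have h0 : 0 < h by rewrite divr_gt0.
have eE : e = h * (4 * t ^+ 2 + 8 * t) by rewrite divfK// gt_eqF.
have [dT [T [P [Y [Y' [Z [Z' [[mY mY' mZ mZ'] [PY PY' PZ PZ'] [YY' ZY Z'Y']]]]]]]]] :=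
  four_point_coupling h0 nu1_P2 nu1'_P2 rho_P2 rho'_P2.
apply: (@le_trans _ _ (msd P Z Z')); first exact: W2sq_le_msd.
have mM := measurable_midpoint mZ mZ'.
have [mu PM] := has_law_exists P mM.
have mu_P2 : P2 mu by exact: P2_midpoint PZ PZ' PM _ _.
have min1 := extrapolation_minimality t_gt1 nu0_P2 nu1_P2 rhoE mu_P2.
have min1' := extrapolation_minimality t_gt1 nu0_P2 nu1'_P2 rho'E mu_P2.
have conc := W2sq_midpoint mZ mZ' PZ PZ' PM (W2sq_fin_num mu_P2 nu0_P2).
have par1 := msd_midpoint P mZ mZ' mY.
have par1' := msd_midpoint P mZ mZ' mY'.
(* With this weight Young's inequality uses up half of the multiple of
   E|Z - Z'|^2 that the parallelogram identities leave over. *)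
have s0 : 0 < (2 * t)^-1 by rewrite invr_gt0 mulr_gt0.
have cross := msd_cross P s0 mZ mZ' mY mY'.
have B := W2sq_le_msd mM mY PM PY.
have B' := W2sq_le_msd mM mY' PM PY'.
have WE (m n : probability (Rd R d) R) : P2 m -> P2 n -> W2sq m n = (fine (W2sq m n))%:E.
  by move=> m2 n2; rewrite fineK// W2sq_fin_num.
have ME (U V : T -> Rd R d) (m n : probability (Rd R d) R) :
    measurable_fun setT U -> measurable_fun setT V ->
    has_law P U m -> has_law P V n -> P2 m -> P2 n -> msd P U V = (fine (msd P U V))%:E.
  move=> mU mV PU PV m2 n2; rewrite fineK// ge0_fin_numE ?msd_ge0//.
  exact: msd_lty PU PV m2 n2.
have G0 := msd_ge0 P Y Y'.
move: YY' ZY Z'Y' conc par1 par1' cross B B' G0.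
rewrite (WE nu1 nu1')// (WE rho nu1)// (WE rho' nu1')// (WE rho nu0)// (WE rho' nu0)//.
rewrite (WE mu nu0)// (WE mu nu1)// (WE mu nu1')//.
rewrite (ME _ _ _ _ mY mY' PY PY')// (ME _ _ _ _ mZ mY PZ PY)// (ME _ _ _ _ mZ' mY' PZ' PY')//.
rewrite (ME _ _ _ _ mZ mZ' PZ PZ')// (ME _ _ _ _ mZ' mY PZ' PY)// (ME _ _ _ _ mZ mY' PZ PY')//.
rewrite (ME _ _ _ _ mM mY PM PY)// (ME _ _ _ _ mM mY' PM PY')//.
rewrite -!EFinM -!EFinD !lee_fin.
move=> YY' ZY Z'Y' conc [par1] [par1'] cross B B' G0.
move: YY' ZY Z'Y' conc par1 par1' cross B B' min1 min1'.
set G := fine (msd P Y Y') in G0 *; set D := fine (msd P Z Z').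
set A := fine (msd P Z Y); set A' := fine (msd P Z' Y').
set K := fine (msd P Z' Y); set K' := fine (msd P Z Y').
set M := fine (msd P _ Y); set M' := fine (msd P _ Y').
set g := fine (W2sq nu1 nu1').
set r1 := fine (W2sq rho nu1); set r1' := fine (W2sq rho' nu1').
set r0 := fine (W2sq rho nu0); set r0' := fine (W2sq rho' nu0).
set m1 := fine (W2sq mu nu1); set m1' := fine (W2sq mu nu1').
set m0 := fine (W2sq mu nu0).
rewrite invrK => YY' ZY Z'Y' conc par1 par1' cross B B' min1 min1'.
have c1 : t * (r1 + r1' - m1 - m1') <= (t - 1) * (2^-1 * D).
  have : (t - 1) * (r0 + r0') <= (t - 1) * (2 * m0 + 2^-1 * D).
    by rewrite ler_wpM2l//; lra.
  by lra.
have c2 : M + M' + 2^-1 * D <= A + A' + 2^-1 * ((2 * t)^-1 * D) + t * G by lra.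
have c3 : t * (A + A' - M - M' - 2 * h) <= (t - 1) * (2^-1 * D).
  by apply: le_trans c1; rewrite ler_pM2l//; lra.
have c4 : t * (M + M' + 2^-1 * D) <=
    t * (A + A') + 2^-1 * (2^-1 * D) + t ^+ 2 * G.
  have := c2; rewrite -(ler_pM2l t0) => /le_trans; apply.
  by rewrite le_eqVlt; apply/orP; left; apply/eqP; field; rewrite gt_eqF.
have c5 : D <= 4 * t ^+ 2 * G + 8 * t * h by lra.
have c6 : t ^+ 2 * G <= t ^+ 2 * (g + h) by rewrite ler_wpM2l// sqr_ge0.
by rewrite eE; lra.
Qed.
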